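(* There is a global constant $C>0$ such that the following holds. Let $n\ge1$, let $\rho\in(0,\frac12)$, and let $\vec p=(p_1,\dots,p_n)$ be the probability vector with $p_i$ proportional to $\rho^{n-i}$. Let $m$ voters vote independently, each voting for candidate $i$ with probability $p_i$, and let $\vec w=(w_1,\dots,w_n)$ where $w_i$ is the number of votes for candidate $i$. (1) Assume $m\ge C\rho^{-n}(2\rho-1)^{-2}\log n$. Let $T\in(0,1]$, say $T\in I^{\vec p}(P)$ with $P\subsetneq\{1,\dots,n\}$. If the distance of $T$ from each of the endpoints $\tilde p(P)$ and $\tilde p(P^+)$ of $I^{\vec p}(P)$ is at least $\Delta=\sqrt{\log(nm)/m}$, then with probability $1-O(1/n)$ (with an absolute implied constant) it holds that for all $i\in\{1,\dots,n\}$, $\varphi_i^{\vec w}(mT)=\varphi_i^{\vec p}(T)$. (2) Furthermore, for fixed $n$ and $\rho$, for all but finitely many values of $T\in(0,1]$, the probability that $\varphi_i^{\vec w}(mT)=\varphi_i^{\vec p}(T)$ tends to $1$ as $m\to\infty$ (for each $i\in\{1,\dots,n\}$).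
   Context: For a vector $\vec u=(u_1,\dots,u_n)$ of nonnegative weights and a quota $q$, $\varphi_i^{\vec u}(q)$ is the Shapley value of agent $i$ in the weighted voting game on $N=\{1,\dots,n\}$: with $v(S)=1$ if $\sum_{j\in S}u_j\ge q$ and $v(S)=0$ otherwise, $\varphi_i^{\vec u}(q)=\frac1{n!}\sum_{\sigma}(v(P_i(\sigma)\cup\{i\})-v(P_i(\sigma)))$, the sum over all permutations $\sigma$ of $N$, where $P_i(\sigma)=\{j:\sigma(j)<\sigma(i)\}$. For $P\subseteq N$ put $\tilde p(P)=\sum_{i\in P}p_{n+1-i}$. (Here $\vec p$ satisfies $\sum_{j<i}p_j<p_i$ for all $i$, so distinct subsets have distinct sums.) For $P\ne N$, $P^+\subseteq N$ is the set whose value $\tilde p(P^+)$ is the next larger subset sum after $\tilde p(P)$ among $\{\tilde p(Q):Q\subseteq N\}$, and $I^{\vec p}(P)=(\tilde p(P),\tilde p(P^+)]$. These intervals partition $(0,1]$. *)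

(* Defs.v *)
From HB Require Import structures.
From mathcomp Require Import all_boot all_order all_algebra all_fingroup.
From mathcomp Require Import all_classical all_reals all_analysis.
Import Order.TTheory GRing.Theory Num.Theory.
Import numFieldNormedType.Exports.

Set Implicit Arguments.
Unset Strict Implicit.
Unset Printing Implicit Defensive.

Local Open Scope ring_scope.

(* Agents and candidates 1, ..., n are the elements 0, ..., n-1 of 'I_n. *)

Section WeightedVotingGame.
Variables (R : realType) (n : nat).
Implicit Types (u : 'I_n -> R) (q : R) (S : {set 'I_n}) (i : 'I_n).

Definition game_value u q S : R :=
  if q <= \sum_(j in S) u j then 1 else 0.

Definition predecessors (s : 'S_n) i : {set 'I_n} :=
  [set j : 'I_n | (s j < s i)%N].

Definition shapley u q i : R :=
  (n`!%:R)^-1 *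
  \sum_(s : 'S_n) (game_value u q (i |: predecessors s i)
                   - game_value u q (predecessors s i)).

End WeightedVotingGame.

Section SubsetSums.
Variables (R : realType) (n : nat) (p : 'I_n -> R).
Implicit Types (P : {set 'I_n}).

(* [rev_ord] is i |-> n + 1 - i in 1-based indexing. *)
Definition subset_sum P : R := \sum_(i in P) p (rev_ord i).

(* P^+; meaningful when the full set has a larger subset sum than P. *)
Definition next_subset P : {set 'I_n} :=
  [arg min_(Q < [set: 'I_n]%SET | (subset_sum P < subset_sum Q)%R)
     subset_sum Q]%O.

Definition subset_sum_itv P : interval R :=
  `]subset_sum P, subset_sum (next_subset P)].

End SubsetSums.

Section Voting.
Variables (R : realType) (n : nat).

(* In 1-based indexing the exponent is n - i. *)
Definition geometric_vector (rho : R) (i : 'I_n) : R :=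
  rho ^+ (n - i.+1) / \sum_(j < n) rho ^+ (n - j.+1).

Definition votes (m : nat) (x : {ffun 'I_m -> 'I_n}) (i : 'I_n) : R :=
  #|[set k : 'I_m | x k == i]|%:R.

(* Probability of the event E when each of m voters independently votes for
   candidate i with probability p i: the product distribution on the
   outcomes x, where x k is the vote of voter k. *)
Definition voting_prob (p : 'I_n -> R) (m : nat)
    (E : pred {ffun 'I_m -> 'I_n}) : R :=
  \sum_(x : {ffun 'I_m -> 'I_n} | E x) \prod_(k < m) p (x k).

End Voting.

(* Main.v *)
Require Import Defs.
From HB Require Import structures.
From mathcomp Require Import all_boot all_order all_algebra all_fingroup.
From mathcomp Require Import all_classical all_reals all_analysis.
From mathcomp Require Import ring lra.
Import Order.TTheory GRing.Theory Num.Theory.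
Import numFieldNormedType.Exports.

Set Implicit Arguments.
Unset Strict Implicit.
Unset Printing Implicit Defensive.

Local Open Scope classical_set_scope.
Local Open Scope ring_scope.

(** Only the order of the subset sums relative to the quota matters.
    If both [p] and the vote vector [w] are superincreasing, then each of them
    orders subsets by the largest index of the symmetric difference, so [w] and
    [p] order all subset sums identically, and the two games agree as soon as
    [w(P) < m T <= w(P^+)].  Each failure is controlled by the Chernoff bound:
    [w] fails to be superincreasing at [i] with probability at most
    [exp (- m d_i^2 / (8 p_i)) <= n^-2], where [d_i = p_i - sum_(j < i) p_j] is
    at least [(1 - 2 rho) p_i] and [p_i >= rho^n]; each threshold inequality
    fails with probability at most [exp (- m Delta^2) = 1 / (n m)].  For (2),
    when [T] is not a subset sum the law of large numbers applies to each of the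
    finitely many [w(S)]. *)

(** Second-order bound for the moment generating function. Only an upper bound on [x] is required,
    so scores taking large negative values cause no trouble. *)
Lemma expR_le_quadratic (R : realType) (x : R) :
  x <= 1 -> expR x <= 1 + x + x ^+ 2.
Proof.
move=> x1.
(* The ratio [g] of the two sides has derivative [x (1 - x) exp (- x)]. *)
pose g (y : R) := (1 + y + y ^+ 2) * expR (- y).
pose dg (y : R) := y * (1 - y) * expR (- y).
have dgE (y : R) : is_derive y 1 g (dg y).
  rewrite /g /dg; apply: is_derive_eq.
  rewrite /GRing.scale /=; ring.
have cg (a b : R) : {within `[a, b], continuous g}.
  apply: continuous_subspaceT => y.
  by apply/differentiable_continuous/derivable1_diffP; case: (dgE y).
have g0 : g 0 = 1 by rewrite /g oppr0 expR0; ring.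
suff : 1 <= g x.
  by rewrite /g expRN ler_pdivlMr ?expR_gt0// mul1r.
rewrite -g0 -subr_ge0.
have [x0|x0] := leP 0 x.
  have [c] := MVT_segment x0 (fun y _ => dgE y) (cg 0 x).
  rewrite in_itv/= => /andP[c0 cx] ->.
  by rewrite subr0 !mulr_ge0 ?expR_ge0// subr_ge0 (le_trans cx).
have [c] := MVT_segment (ltW x0) (fun y _ => dgE y) (cg x 0).
rewrite in_itv/= => /andP[cx c0] gE.
rewrite -opprB gE -mulrN opprB subr0 mulr_le0 ?(ltW x0)//.
rewrite /dg -mulrA mulr_le0_ge0// ?mulr_ge0 ?expR_ge0//.
by rewrite subr_ge0 (le_trans c0).
Qed.

(** * Tail bounds for vote counts *)

Section VotingProb.
Variables (R : realType) (n : nat) (p : 'I_n -> R) (m : nat).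
Hypotheses (p_ge0 : forall i, 0 <= p i) (p_sum1 : \sum_i p i = 1).
Implicit Types (E : pred {ffun 'I_m -> 'I_n}) (f : 'I_n -> R) (S : {set 'I_n}).

Lemma voting_prob_predT : voting_prob p (m := m) predT = 1.
Proof.
rewrite /voting_prob; under eq_bigl do rewrite inE.
by rewrite -(bigA_distr_bigA (fun=> p))/= big1.
Qed.

Lemma prod_prob_ge0 (x : {ffun 'I_m -> 'I_n}) : 0 <= \prod_(k < m) p (x k).
Proof. exact: prodr_ge0. Qed.

(** Union bound: the bad events [B i] cover the complement of [E]. *)
Lemma voting_prob_ge_compl (I : finType) (B : I -> pred {ffun 'I_m -> 'I_n}) E :
  (forall x, ~~ E x -> exists i, B i x) ->
  1 - \sum_i voting_prob p (B i) <= voting_prob p E.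
Proof.
move=> EB; rewrite lerBlDl -voting_prob_predT /voting_prob.
rewrite (bigID E)/= addrC lerD//.
under [leRHS]eq_bigr do rewrite big_mkcond/=.
rewrite exchange_big/= [leLHS]big_mkcond; apply: ler_sum => x _.
have nn i : 0 <= (if B i x then \prod_(k < m) p (x k) else 0).
  by case: ifP => _; rewrite ?prod_prob_ge0.
case: ifP => [/EB[i Bi]|_]; last exact: sumr_ge0.
by rewrite (bigD1 i)//= Bi lerDl sumr_ge0.
Qed.

Lemma voting_prob_le1 E : voting_prob p E <= 1.
Proof.
rewrite -voting_prob_predT /voting_prob [leRHS](bigID E)/= lerDl.
by apply: sumr_ge0 => x _; exact: prod_prob_ge0.
Qed.

Lemma votes_sum f (x : {ffun 'I_m -> 'I_n}) :
  \sum_i f i * votes R x i = \sum_(k < m) f (x k).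
Proof.
rewrite (partition_big x predT)//=; apply: eq_bigr => i _.
rewrite (eq_bigr (fun=> f i)) => [|k /eqP->//].
by rewrite sumr_const mulr_natr /votes cardsE.
Qed.

Lemma votes_sum_in S (x : {ffun 'I_m -> 'I_n}) :
  \sum_(i in S) votes R x i = \sum_(k < m) (x k \in S)%:R.
Proof.
rewrite -(votes_sum (fun i => (i \in S)%:R)) big_mkcond/=.
by apply: eq_bigr => i _; case: ifP; rewrite ?mul1r ?mul0r.
Qed.

(** Markov's inequality for the exponential of the total score: this weight is at least 1 on [E],
    and by independence its expectation is an [m]-th power. *)
Lemma voting_prob_mgf f E :
  (forall x, E x -> 0 <= \sum_(k < m) f (x k)) ->
  voting_prob p E <= (\sum_i p i * expR (f i)) ^+ m.
Proof.
move=> Ef; rewrite -[in leRHS](card_ord m) -prodr_const bigA_distr_bigA/=.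
rewrite /voting_prob big_mkcond; apply: ler_sum => x _; rewrite big_split/=.
case: ifP => [/Ef fx|_]; last by rewrite mulr_ge0 ?prodr_ge0// => k _; exact: expR_ge0.
by rewrite -expR_sum ler_peMr ?prod_prob_ge0// -expR0 ler_expR.
Qed.

(** Tilt by [lambda * (f - t)]. The quadratic bound on the exponential, followed by
    [1 + y <= expR y], leaves only the first two moments of [f] in the exponent. *)
Lemma voting_prob_chernoff f (t lambda : R) E :
  0 <= lambda <= 1 -> (forall i, f i <= 1) ->
  (forall x, E x -> m%:R * t <= \sum_(k < m) f (x k)) ->
  voting_prob p E <= expR (m%:R *
    (lambda * (\sum_i p i * f i - t) + lambda ^+ 2 * \sum_i p i * f i ^+ 2)).
Proof.
move=> /andP[l0 l1] f1 Ef.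
have H x : E x -> 0 <= \sum_(k < m) lambda * (f (x k) - t).
  move=> /Ef; rewrite -mulr_sumr sumrB sumr_const card_ord -[t *+ m]mulr_natl => ?.
  by rewrite mulr_ge0// subr_ge0.
apply: le_trans (voting_prob_mgf (f := fun i => lambda * (f i - t)) H) _.
rewrite expRM_natl lerXn2r ?nnegrE ?expR_ge0//.
  by apply: sumr_ge0 => i _; rewrite mulr_ge0 ?expR_ge0.
under eq_bigr => i _ do rewrite mulrBr expRB mulrA.
rewrite -mulr_suml ler_pdivrMr ?expR_gt0// -expRD.
rewrite mulrBr addrAC addrNK.
apply: le_trans (expR_ge1Dx _).
rewrite !mulr_sumr -p_sum1 -!big_split/=; apply: ler_sum => i _.
have fl : lambda * f i <= 1.
  have [fi|fi] := leP 0 (f i); first by rewrite mulr_ile1.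
  by rewrite (le_trans (mulr_ge0_le0 l0 (ltW fi))).
apply: le_trans (ler_wpM2l (p_ge0 i) (expR_le_quadratic fl)) _.
by rewrite le_eqVlt; apply/orP; left; apply/eqP; ring.
Qed.

(** Chernoff for the centred indicator of [S] with [lambda = 2 * e], which is at most 1 because
    [e <= 1 / 2]. The variance [a - a ^+ 2] is at most 1/4, so the exponent per voter is at most
    [- 2 e^2 + e^2]. *)
Lemma voting_prob_upper_tail S (T e : R) E :
  0 <= e <= 1 / 2 -> \sum_(i in S) p i + e <= T ->
  (forall x, E x -> m%:R * T <= \sum_(i in S) votes R x i) ->
  voting_prob p E <= expR (- (m%:R * e ^+ 2)).
Proof.
move=> /andP[e0 e1] ST ET; set a := \sum_(i in S) p i in ST.
have a0 : 0 <= a by exact: sumr_ge0.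
have sumS : \sum_i p i * (i \in S)%:R = a.
  by rewrite /a [RHS]big_mkcond; apply: eq_bigr => i _; case: ifP; rewrite ?mulr1 ?mulr0.
apply: (le_trans (@voting_prob_chernoff (fun i => (i \in S)%:R - a) e (2 * e) E _ _ _)).
- by apply/andP; split; lra.
- by move=> i; case: (i \in S) => /=; lra.
- move=> x /ET; rewrite votes_sum_in sumrB sumr_const card_ord => TS.
  rewrite lerBrDr -[a *+ m]mulr_natl -mulrDr addrC (le_trans _ TS)//.
  by rewrite ler_wpM2l.
have -> : \sum_i p i * ((i \in S)%:R - a) = 0.
  by under eq_bigr do rewrite mulrBr; rewrite sumrB -mulr_suml p_sum1 sumS; ring.
have -> : \sum_i p i * ((i \in S)%:R - a) ^+ 2 = a - a ^+ 2.
  rewrite (eq_bigr (fun i => (p i * (i \in S)%:R) * (1 - 2 * a) + p i * a ^+ 2)).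
    by rewrite big_split/= -!mulr_suml p_sum1 sumS; ring.
  by move=> i _; case: (i \in S) => /=; ring.
rewrite ler_expR -[leRHS]mulrN ler_wpM2l//.
(* This square encodes the variance bound, scaled by [e ^+ 2]. *)
have : 0 <= (e * (a - 1 / 2)) ^+ 2 by exact: sqr_ge0.
nra.
Qed.

(** Few votes for [S] means many votes for its complement, so the upper tail applies with threshold
    [1 - T]. *)
Lemma voting_prob_lower_tail S (T e : R) E :
  0 <= e <= 1 / 2 -> T + e <= \sum_(i in S) p i ->
  (forall x, E x -> \sum_(i in S) votes R x i <= m%:R * T) ->
  voting_prob p E <= expR (- (m%:R * e ^+ 2)).
Proof.
move=> e01 TS ET; apply: (voting_prob_upper_tail (S := ~: S) (T := 1 - T)) => //.
  rewrite (eq_bigl (fun i => i \notin S)) => [|i]; last by rewrite inE.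
  by move: p_sum1; rewrite (bigID (mem S))/= => ?; lra.
move=> x /ET; rewrite !votes_sum_in => ST.
under eq_bigr do rewrite inE.
rewrite (eq_bigr (fun k => 1 - (x k \in S)%:R)); last first.
  by move=> k _; case: (x k \in S); rewrite /= ?subr0 ?subrr.
by rewrite sumrB sumr_const card_ord mulrBr mulr1 lerB.
Qed.

Lemma voting_prob_superincreasing_fails i E : 0 < p i ->
  \sum_(j < n | (j < i)%N) p j <= p i ->
  (forall x, E x -> votes R x i <= \sum_(j < n | (j < i)%N) votes R x j) ->
  voting_prob p E <=
    expR (- (m%:R * (p i - \sum_(j < n | (j < i)%N) p j) ^+ 2 / (8 * p i))).
Proof.
move=> pi0; set q := \sum_(j < n | _) p j => qp Ei.
have q0 : 0 <= q by exact: sumr_ge0.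
(* The total score is the margin by which the candidates below [i] beat [i]; its mean per voter is
   [q - p i] and its second moment [q + p i]. *)
pose f (j : 'I_n) : R := (j < i)%N%:R - (j == i)%:R.
have sumf (g : 'I_n -> R) :
    \sum_j f j * g j = \sum_(j < n | (j < i)%N) g j - g i.
  rewrite /f; under eq_bigr do rewrite mulrBl.
  rewrite sumrB; congr (_ - _).
    by rewrite [RHS]big_mkcond; apply: eq_bigr => j _; case: ifP; rewrite ?mul1r ?mul0r.
  by rewrite (bigD1 i)//= eqxx mul1r big1 ?addr0// => j /negPf->; rewrite mul0r.
(* With the second moment bounded by [2 * p i], this is the minimiser of
   [- l * (p i - q) + 2 * p i * l ^+ 2]. *)
pose l := (p i - q) / (4 * p i).
have l01 : 0 <= l <= 1.
  by rewrite /l divr_ge0 ?ler_pdivrMr/= ?mulr_gt0//; lra.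
apply: (le_trans (@voting_prob_chernoff f 0 l E l01 _ _)).
- by move=> j; rewrite /f; case: (j < i)%N; case: (j == i) => /=; lra.
- by move=> x /Ei; rewrite mulr0 -votes_sum sumf subr_ge0.
have -> : \sum_j p j * f j = q - p i.
  by under eq_bigr do rewrite mulrC; rewrite sumf.
have -> : \sum_j p j * f j ^+ 2 = q + p i.
  rewrite (eq_bigr (fun j => f j * p j + 2 * ((j == i)%:R * p j))); last first.
    move=> j _; rewrite /f; have [->|ji] := eqVneq j i.
      by rewrite ltnn /=; ring.
    by case: (j < i)%N => /=; ring.
  have pE : \sum_j (j == i)%:R * p j = p i.
    rewrite (bigD1 i)//= eqxx mul1r big1 ?addr0// => j /negPf->.
    by rewrite mul0r.
  by rewrite big_split/= sumf -mulr_sumr pE -/q; ring.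
rewrite ler_expR -[in leRHS]mulrA -[leRHS]mulrN ler_wpM2l// subr0.
(* The cubic term is the gain from [q + p i] being below [2 * p i]; it has the right sign and is
   dropped. *)
have -> : l * (q - p i) + l ^+ 2 * (q + p i) =
    - ((p i - q) ^+ 2 / (8 * p i)) - (p i - q) ^+ 3 / (16 * p i ^+ 2).
  by rewrite /l; field; rewrite gt_eqF.
by rewrite mulrA gerBl divr_ge0 ?exprn_ge0 ?mulr_ge0 ?exprn_ge0 ?subr_ge0// ltW.
Qed.

End VotingProb.

Lemma eq_shapley (R : realType) (n : nat) (u w : 'I_n -> R) (q t : R) (i : 'I_n) :
  (forall S : {set 'I_n}, (q <= \sum_(j in S) u j) = (t <= \sum_(j in S) w j)) ->
  shapley u q i = shapley w t i.
Proof.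
move=> qt; congr (_ * _); apply: eq_bigr => s _.
by rewrite /game_value !qt.
Qed.

(** * Superincreasing weights and the order of coalitions *)

Section Superincreasing.
Variables (R : realType) (n : nat).
Implicit Types (u w : 'I_n -> R) (S Q A B : {set 'I_n}).

Definition superincreasing u :=
  forall i : 'I_n, \sum_(j < n | (j < i)%N) u j < u i.

(** Above [i] the two sets contribute equally; below [i], all that [S] can collect is less than
    [u i], which [Q] has. *)
Lemma superincreasing_lt u S Q i :
  (forall j, 0 <= u j) -> superincreasing u ->
  i \in Q -> i \notin S -> (forall j : 'I_n, (i < j)%N -> (j \in S) = (j \in Q)) ->
  \sum_(j in S) u j < \sum_(j in Q) u j.
Proof.
move=> u0 su iQ iS SQ.
rewrite (bigID (fun j : 'I_n => i < j)%N)/= [ltRHS](bigID (fun j : 'I_n => i < j)%N)/=.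
rewrite (eq_bigl (fun j : 'I_n => (j \in Q) && (i < j)%N)); last first.
  by move=> j; have [/SQ->|] := boolP (i < j)%N; rewrite ?andbF.
rewrite ltrD2l [ltRHS](bigD1 i)/=; last by rewrite iQ ltnn.
apply: (@lt_le_trans _ _ (u i)); last by rewrite lerDl sumr_ge0.
apply: le_lt_trans (su i).
rewrite [leLHS]big_mkcond [leRHS]big_mkcond/=; apply: ler_sum => j _.
case: ifP => [/andP[jS]|_]; last by case: ifP.
rewrite -leqNgt leq_eqVlt => /orP[/eqP/val_inj ji|->//].
by rewrite ji (negPf iS) in jS.
Qed.

Lemma superincreasing_same_order u w S Q :
  (forall j, 0 <= u j) -> superincreasing u ->
  (forall j, 0 <= w j) -> superincreasing w ->
  (\sum_(j in S) u j < \sum_(j in Q) u j) = (\sum_(j in S) w j < \sum_(j in Q) w j).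
Proof.
move=> u0 su w0 sw.
have [->|SQ] := eqVneq S Q; first by rewrite !ltxx.
have [i0 i0P] : exists i, (i \in S) != (i \in Q).
  apply/existsP; apply: contraNT SQ => /existsPn SQ.
  by apply/eqP/setP => i; apply/eqP; rewrite -[_ == _]negbK.
(* The comparison is decided by the largest index on which the sets differ. *)
case: (@arg_maxnP _ i0 (fun i => (i \in S) != (i \in Q)) val i0P) => i iP imax.
have SQi (j : 'I_n) : (i < j)%N -> (j \in S) = (j \in Q).
  by move=> ij; apply/eqP; apply: contraTT ij => /imax; rewrite -leqNgt.
move: iP; have [iQ|iQ] := boolP (i \in Q); have [iS|iS] := boolP (i \in S) => // _.
  by rewrite (superincreasing_lt u0 su iQ iS SQi) (superincreasing_lt w0 sw iQ iS SQi).
have QSi (j : 'I_n) : (i < j)%N -> (j \in Q) = (j \in S) by move=> /SQi.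
by rewrite (lt_gtF (superincreasing_lt u0 su iS iQ QSi))
           (lt_gtF (superincreasing_lt w0 sw iS iQ QSi)).
Qed.

(** [A] and [B] carry consecutive subset sums for [u], so winning at a quota between them means
    weighing at least as much as [B]. That condition depends only on the order, which [w] shares. *)
Lemma superincreasing_same_winners u w A B (q t : R) :
  (forall j, 0 <= u j) -> superincreasing u ->
  (forall j, 0 <= w j) -> superincreasing w ->
  (forall S, \sum_(j in A) u j < \sum_(j in S) u j ->
             \sum_(j in B) u j <= \sum_(j in S) u j) ->
  \sum_(j in A) u j < q <= \sum_(j in B) u j ->
  \sum_(j in A) w j < t <= \sum_(j in B) w j ->
  forall S, (t <= \sum_(j in S) w j) = (q <= \sum_(j in S) u j).
Proof.
move=> u0 su w0 sw ABnext /andP[Aq qB] /andP[At tB] S.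
have [qS|Sq] := leP q (\sum_(j in S) u j).
  apply: (le_trans tB); rewrite leNgt -(superincreasing_same_order _ _ u0 su w0 sw).
  by rewrite -leNgt ABnext// (lt_le_trans Aq).
apply/negbTE; rewrite -ltNge; apply: le_lt_trans At.
rewrite leNgt -(superincreasing_same_order _ _ u0 su w0 sw).
by apply: contraTN Sq => /ABnext BS; rewrite -leNgt (le_trans qB).
Qed.

(** Moves the index reversal from the weights to the set, so that the order lemmas for plain sums
    apply. *)
Lemma subset_sum_imset u S :
  subset_sum u S = \sum_(j in @rev_ord n @: S) u j.
Proof. by rewrite /subset_sum big_imset// => i j _ _; exact: rev_ord_inj. Qed.

Lemma next_subset_min u (P Q : {set 'I_n}) : (forall i, 0 < u i) -> P \proper [set: 'I_n]%SET ->
  subset_sum u P < subset_sum u Q ->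
  subset_sum u (next_subset u P) <= subset_sum u Q.
Proof.
move=> u0 /properP[_ [i _ iP]] PQ.
rewrite /next_subset; case: arg_minP => [|k _]; last by apply.
(* The default of the [arg min], the full set, must itself be a candidate: it exceeds [P] by the
   positive weight of some index outside [P]. *)
rewrite /subset_sum [ltRHS](bigID (mem P))/=.
rewrite [X in _ < X + _](eq_bigl (mem P)) => [|j]; last by rewrite !inE.
by rewrite ltrDl (bigD1 i)/= ?inE//= ltr_pwDl// sumr_ge0// => j _; exact: ltW.
Qed.

Lemma next_subset_gap u (P S : {set 'I_n}) : (forall i, 0 < u i) -> P \proper [set: 'I_n]%SET ->
  \sum_(j in @rev_ord n @: P) u j < \sum_(j in S) u j ->
  \sum_(j in @rev_ord n @: (next_subset u P)) u j <= \sum_(j in S) u j.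
Proof.
move=> u0 PT; have -> : S = @rev_ord n @: (@rev_ord n @: S).
  rewrite -imset_comp -[LHS]imset_id; apply: eq_imset => i /=.
  by rewrite rev_ordK.
by rewrite -!subset_sum_imset; exact: next_subset_min.
Qed.

End Superincreasing.

(** * Estimates for the geometric vector *)

Section GeometricVector.
Variables (R : realType) (n : nat) (rho : R).
Hypotheses (rho_gt0 : 0 < rho) (rho_lt : rho < 1 / 2).
Let p : 'I_n -> R := geometric_vector rho.
Let Z := \sum_(j < n) rho ^+ (n - j.+1).

(** Geometric series bound in division-free form; the induction step is the identity
    [rho * y + (1 - rho) * y = y] with [y = rho ^+ (n - k.+1)]. *)
Lemma geometric_prefix_sum (k : nat) : (k <= n)%N ->
  (1 - rho) * \sum_(j < k) rho ^+ (n - j.+1) <= rho ^+ (n - k).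
Proof.
elim: k => [_|k IH kn]; first by rewrite big_ord0 mulr0 exprn_ge0// ltW.
rewrite big_ord_recr/= mulrDr (le_trans (lerD (IH (ltnW kn)) (lexx _)))//.
by rewrite -(subnSK kn) exprS mulrBl mul1r addrC subrK.
Qed.

Hypothesis n_gt0 : (0 < n)%N.

Lemma geometric_norm_gt0 : 0 < Z.
Proof.
rewrite /Z (bigD1 (Ordinal n_gt0))//= ltr_pwDl ?exprn_gt0//.
by apply: sumr_ge0 => j _; rewrite exprn_ge0// ltW.
Qed.

Lemma geometric_vector_gt0 i : 0 < p i.
Proof. by rewrite divr_gt0 ?exprn_gt0// geometric_norm_gt0. Qed.

Lemma geometric_vector_sum1 : \sum_i p i = 1.
Proof. by rewrite -mulr_suml divff// gt_eqF// geometric_norm_gt0. Qed.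

(** The series gives the ratio [rho / (1 - rho)], and [1 / (1 - rho) <= 2] since [rho < 1 / 2]. *)
Lemma geometric_vector_prefix (i : 'I_n) :
  \sum_(j < n | (j < i)%N) p j <= 2 * rho * p i.
Proof.
rewrite -mulr_suml mulrA ler_pM2r ?invr_gt0 ?geometric_norm_gt0//.
rewrite -(big_ord_widen n (fun j => rho ^+ (n - j.+1)) (ltnW (ltn_ord i))).
have := geometric_prefix_sum (ltnW (ltn_ord i)).
rewrite -(subnSK (ltn_ord i)) exprS.
set s := \sum_(j < i) _ => H.
have s0 : 0 <= s by apply: sumr_ge0 => j _; rewrite exprn_ge0// ltW.
by move: rho_lt; nra.
Qed.

(** The smallest numerator is [rho ^+ n.-1], and [rho * Z <= 1] because [(1 - rho) * Z <= 1] and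
    [rho <= 1 - rho]. *)
Lemma geometric_vector_ge i : rho ^+ n <= p i.
Proof.
rewrite ler_pdivlMr ?geometric_norm_gt0//.
have := geometric_prefix_sum (leqnn n); rewrite subnn expr0 -/Z => H.
have r1 : rho <= 1 by move: rho_lt; lra.
have nE : n = (n.-1).+1 by rewrite prednK.
have rn : rho ^+ n.-1 <= rho ^+ (n - i.+1).
  rewrite ler_wiXn2l ?(ltW rho_gt0)//.
  by rewrite subnS -!subn1 leq_sub2r// leq_subr.
apply: le_trans rn; rewrite {1}nE exprSr -mulrA ler_piMr ?exprn_ge0// ?ltW//.
by have := geometric_norm_gt0; rewrite -/Z => ?; move: rho_lt; nra.
Qed.

Lemma geometric_vector_superincreasing : superincreasing p.
Proof.
move=> i; apply: le_lt_trans (geometric_vector_prefix i) _.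
by rewrite gtr_pMl ?geometric_vector_gt0//; move: rho_lt; lra.
Qed.

Lemma geometric_vector_excess (i : 'I_n) :
  rho ^+ n * (2 * rho - 1) ^+ 2 <=
    (p i - \sum_(j < n | (j < i)%N) p j) ^+ 2 / p i.
Proof.
have pi0 := geometric_vector_gt0 i.
apply: (@le_trans _ _ (p i * (2 * rho - 1) ^+ 2)).
  by rewrite ler_wpM2r ?sqr_ge0// geometric_vector_ge.
(* [2 * rho - 1] is negative; the sign is flipped before taking square roots. *)
rewrite ler_pdivlMr// mulrAC -expr2 -exprMn -[leLHS]sqrrN.
rewrite lerXn2r ?nnegrE//; have := geometric_vector_prefix i => H; move: rho_lt; nra.
Qed.

End GeometricVector.

(** * Convergence for fixed [n] and [p] *)

Lemma voting_prob_close (R : realType) (n m : nat) (p : 'I_n -> R) (T e : R) (i : 'I_n) :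
  (forall j, 0 <= p j) -> \sum_j p j = 1 -> 0 <= e <= 1 / 2 ->
  (forall S : {set 'I_n}, e <= `|T - \sum_(j in S) p j|) ->
  1 - #|{set 'I_n}|%:R * expR (- e ^+ 2) ^+ m <=
  voting_prob p (fun x : {ffun 'I_m -> 'I_n} =>
    shapley (votes R x) (m%:R * T) i == shapley p T i).
Proof.
move=> p0 p1 e01 eT.
(* Coalition [S] changes status only if its vote share deviates from its mean by at least [e]; a
   union bound runs over all coalitions. *)
pose B (S : {set 'I_n}) (x : {ffun 'I_m -> 'I_n}) :=
  (m%:R * T <= \sum_(j in S) votes R x j) != (T <= \sum_(j in S) p j).
apply: le_trans (voting_prob_ge_compl (B := B) p0 p1 _).
  rewrite lerD2l lerN2 mulr_natl -[leRHS](sumr_const {set 'I_n}).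
  apply: ler_sum => S _; rewrite -expRM_natl mulrN.
  have [TS|ST] := leP T (\sum_(j in S) p j).
    apply: (voting_prob_lower_tail p0 p1 (S := S) (T := T)) => //.
      by have := eT S; rewrite distrC ger0_norm ?subr_ge0// lerBrDl.
    by move=> x; rewrite /B TS eqb_id -ltNge => /ltW.
  apply: (voting_prob_upper_tail p0 p1 (S := S) (T := T)) => //.
    by have := eT S; rewrite ger0_norm ?subr_ge0 ?(ltW ST)// lerBrDl.
  by move=> x; rewrite /B (lt_geF ST)/=; case: (m%:R * T <= _).
move=> x xi; apply/existsP; apply: contraNT xi => /existsPn xB.
by apply/eqP/eq_shapley => S; apply/eqP; rewrite -[_ == _]negbK; exact: xB.
Qed.

Lemma finite_subset_sums (R : realType) (n : nat) (p : 'I_n -> R) :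
  finite_set [set \sum_(j in S) p j | S in [set: {set 'I_n}]].
Proof. by apply: finite_image; exact: finite_finset. Qed.

Lemma voting_prob_shapley_cvg1 (R : realType) (n : nat) (p : 'I_n -> R) (T : R) (i : 'I_n) :
  (forall j, 0 <= p j) -> \sum_j p j = 1 ->
  (forall S : {set 'I_n}, T != \sum_(j in S) p j) ->
  (fun m : nat => voting_prob p (fun x : {ffun 'I_m -> 'I_n} =>
     shapley (votes R x) (m%:R * T) i == shapley p T i)) @ \oo --> (1 : R).
Proof.
move=> p0 p1 TS.
(* Distance from [T] to the subset sums, capped at 1/2 as the tail bounds demand. *)
pose e := \big[Num.min/(1 / 2 : R)]_(S : {set 'I_n}) `|T - \sum_(j in S) p j|.
have e0 : 0 < e.
  by apply: lt_bigmin => [|S _]; rewrite ?normr_gt0 ?subr_eq0//; lra.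
have e12 : e <= 1 / 2 by exact: bigmin_le_id.
have eT (S : {set 'I_n}) : e <= `|T - \sum_(j in S) p j| by exact: bigmin_le.
have r1 : `|expR (- e ^+ 2)| < 1 :> R.
  by rewrite ger0_norm ?expR_ge0// -expR0 ltr_expR oppr_lt0 exprn_gt0.
apply: (@squeeze_cvgr _ _ _ _
  (fun m => 1 - #|{set 'I_n}|%:R * expR (- e ^+ 2) ^+ m) (cst 1)).
- apply: nearW => m; rewrite voting_prob_le1// andbT.
  by apply: voting_prob_close => //; rewrite (ltW e0).
- rewrite -[X in _ --> X]subr0; apply: cvgB; first exact: cvg_cst.
  rewrite -[X in _ --> X](mulr0 #|{set 'I_n}|%:R); apply: cvgMr.
  exact: cvg_expr.
- exact: cvg_cst.
Qed.

(** * The quantitative bound *)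

Lemma expR_sqrt_ln_le (R : realType) (n m : nat) : (0 < n)%N -> (0 < m)%N ->
  expR (- (m%:R * Num.sqrt (ln (n * m)%:R / m%:R) ^+ 2)) <= n%:R^-1 :> R.
Proof.
move=> n0 m0; have mR : (0 : R) < m%:R by rewrite ltr0n.
have nm1 : (1 : R) <= (n * m)%:R by rewrite ler1n muln_gt0 n0.
rewrite sqr_sqrtr ?divr_ge0 ?ln_ge0// mulrC divfK ?gt_eqF//.
rewrite expRN lnK ?posrE ?(lt_le_trans ltr01)//.
by rewrite lef_pV2 ?posrE ?ltr0n ?muln_gt0 ?n0// ler_nat leq_pmulr.
Qed.

(** Source of the constant 16: the exponent carries a factor 1/8 and must reach [2 * ln n], so that
    a union over [n] candidates still costs only [1 / n]. *)
Lemma expR_excess_le (R : realType) (n m : nat) (rho d : R) :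
  (0 < n)%N -> 0 < rho -> rho < 1 / 2 ->
  rho ^+ n * (2 * rho - 1) ^+ 2 <= d ->
  16 * rho ^- n * (2 * rho - 1) ^- 2 * ln n%:R <= m%:R ->
  expR (- (m%:R * d / 8)) <= (n%:R ^+ 2)^-1 :> R.
Proof.
move=> n0 r0 r12 rd rm.
have c0 : 0 < rho ^+ n * (2 * rho - 1) ^+ 2.
  by rewrite mulr_gt0 ?[0 < rho ^+ n]exprn_gt0// exprn_even_gt0//= lt_eqF//; lra.
rewrite -[in leRHS](@lnK _ n%:R) ?posrE ?ltr0n// -expRM_natl -expRN ler_expR lerN2.
rewrite ler_pdivlMr//.
have : 16 * ln n%:R <= m%:R * (rho ^+ n * (2 * rho - 1) ^+ 2).
  rewrite -ler_pdivrMr// invfM; apply: le_trans rm.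
  by rewrite le_eqVlt; apply/orP; left; apply/eqP; ring.
have : m%:R * (rho ^+ n * (2 * rho - 1) ^+ 2) <= m%:R * d by rewrite ler_wpM2l.
lra.
Qed.

Lemma voting_prob_shapley_eq (R : realType) (n m : nat) (rho T : R) (P : {set 'I_n}) :
  (0 < n)%N -> (0 < m)%N -> 0 < rho -> rho < 1 / 2 ->
  let p : 'I_n -> R := geometric_vector rho in
  16 * rho ^- n * (2 * rho - 1) ^- 2 * ln n%:R <= m%:R ->
  P \proper [set: 'I_n]%SET -> T \in subset_sum_itv p P ->
  let Delta := Num.sqrt (ln (n * m)%:R / m%:R) in
  Delta <= `|T - subset_sum p P| ->
  Delta <= `|T - subset_sum p (next_subset p P)| ->
  1 - 3 / n%:R <= voting_prob p (fun x : {ffun 'I_m -> 'I_n} =>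
    [forall i, shapley (votes R x) (m%:R * T) i == shapley p T i]).
Proof.
move=> n0 m0 r0 r12 p rm PT TP D Da Db.
move: TP; rewrite in_itv/= => /andP[aT Tb].
have p_gt0 i : 0 < p i by exact: geometric_vector_gt0.
have p0 i : 0 <= p i by exact: ltW.
have p1 : \sum_i p i = 1 by exact: geometric_vector_sum1.
have sp : superincreasing p by exact: geometric_vector_superincreasing.
rewrite !subset_sum_imset in aT Tb Da Db.
set A := _ @: P in aT Da; set B := _ @: _ in Tb Db.
rewrite gtr0_norm ?subr_gt0// in Da.
rewrite distrC ger0_norm ?subr_ge0// in Db.
have A0 : 0 <= \sum_(j in A) p j by exact: sumr_ge0.
have B1 : \sum_(j in B) p j <= 1.
  by rewrite -p1 [leRHS](bigID (mem B))/= lerDl sumr_ge0.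
(* [T] is [D] away from both ends of an interval inside [0, 1], whence [2 * D <= 1]. *)
have D01 : 0 <= D <= 1 / 2 by apply/andP; split; [exact: sqrtr_ge0|lra].
pose bad (k : 'I_n + bool) (x : {ffun 'I_m -> 'I_n}) := match k with
  | inl i => votes R x i <= \sum_(j < n | (j < i)%N) votes R x j
  | inr true => m%:R * T <= \sum_(j in A) votes R x j
  | inr false => \sum_(j in B) votes R x j < m%:R * T end.
apply: le_trans (voting_prob_ge_compl (B := bad) p0 p1 _); last first.
  move=> x /forallPn[i xi]; apply/existsP; apply: contraNT xi => /existsPn good.
  apply/eqP/eq_shapley/(@superincreasing_same_winners _ _ p (votes R x) A B) => //.
  - by move=> j; rewrite ltNge; exact: (good (inl j)).
  - by move=> S; exact: next_subset_gap.
  - by rewrite aT Tb.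
  - by have := good (inr true); have := good (inr false); rewrite /= -leNgt -ltNge => -> ->.
rewrite lerD2l lerN2 big_sumType/= big_bool/=.
(* One share [1 / n] for all superincreasing failures together, and one for each of the two
   thresholds. *)
have nE : 3 / n%:R = \sum_(i < n) ((n%:R : R) ^+ 2)^-1 + (n%:R^-1 + n%:R^-1).
  by rewrite sumr_const card_ord -mulr_natr; field; rewrite gt_eqF// ltr0n.
rewrite nE lerD//; [apply: ler_sum => i _|apply: lerD].
- apply: le_trans (expR_excess_le n0 r0 r12
    (geometric_vector_excess r0 r12 n0 i) rm).
  apply: le_trans (voting_prob_superincreasing_fails p0 p1 (p_gt0 i) (ltW (sp i)) _) _.
    by [].
  have assoc (a b c : R) : a * (b / c) / 8 = a * b / (8 * c) by rewrite invfM; ring.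
  by rewrite ler_expR lerN2 -/p assoc.
- apply: le_trans (expR_sqrt_ln_le R n0 m0).
  by apply: (voting_prob_upper_tail p0 p1 (S := A) (T := T)) => //; rewrite -lerBrDl.
- apply: le_trans (expR_sqrt_ln_le R n0 m0).
  apply: (voting_prob_lower_tail p0 p1 (S := B) (T := T)) => //; first by rewrite -lerBrDl.
  by move=> x /ltW.
Qed.

Theorem theorem5p1 (R : realType) :
  exists C : R, 0 < C /\
  exists K : R, 0 < K /\
  forall (n : nat) (rho : R), (1 <= n)%N -> 0 < rho -> rho < 1 / 2 ->
  let p : 'I_n -> R := geometric_vector rho in
  (forall m : nat, (1 <= m)%N ->
     C * rho ^- n * (2 * rho - 1) ^- 2 * ln n%:R <= m%:R ->
     forall (T : R) (P : {set 'I_n}),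
       0 < T -> T <= 1 -> P \proper [set: 'I_n]%SET ->
       T \in subset_sum_itv p P ->
       let Delta := Num.sqrt (ln (n * m)%:R / m%:R) in
       Delta <= `|T - subset_sum p P| ->
       Delta <= `|T - subset_sum p (next_subset p P)| ->
       1 - K / n%:R <=
       voting_prob p (fun x : {ffun 'I_m -> 'I_n} =>
         [forall i : 'I_n,
            shapley (votes R x) (m%:R * T) i == shapley p T i]))
  /\
  finite_set [set T : R | (0 < T <= 1) /\
    ~ (forall i : 'I_n,
         (fun m : nat =>
            voting_prob p (fun x : {ffun 'I_m -> 'I_n} =>
              shapley (votes R x) (m%:R * T) i == shapley p T i))
         @ \oo --> (1 : R))].
Proof.
exists 16; split; first by [].
exists 3; split; first by [].
move=> n rho n0 r0 r12 p; split=> [m m0 rm T P _ _ PT TP D Da Db|].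
  exact: (voting_prob_shapley_eq n0 m0 r0 r12 rm PT TP Da Db).
(* Every exceptional [T] is a subset sum of [p]. *)
apply: sub_finite_set (finite_subset_sums p) => T /= [_ nT].
apply: contrapT => Tsum; apply: nT => i; apply: voting_prob_shapley_cvg1.
- by move=> j; exact/ltW/geometric_vector_gt0.
- exact: geometric_vector_sum1.
- by move=> S; apply/eqP => TS; apply: Tsum; exists S.
Qed.
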